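(* Let $T$ be an unbounded, locally finite metric space with root $o$, and let $\varphi$ and $\psi$ be self-maps of $T$ with $\varphi\neq\psi$. Then the operator norm of $C_\varphi-C_\psi$ on $L^\infty(T)$ is $\|C_\varphi-C_\psi\|=2$.
   Context: A metric space $(T,d)$ with a distinguished point $o$ (the root) is locally finite if for every $M>0$ the set $\{v\in T : d(o,v)<M\}$ is finite; it is unbounded if for every $M>0$ there is $v\in T$ with $d(o,v)\ge M$. $L^\infty(T)$ is the Banach space of bounded functions $f:T\to\mathbb{C}$ with norm $\|f\|_\infty=\sup_{v\in T}|f(v)|$. A self-map of $T$ is an arbitrary function $\varphi:T\to T$; the composition operator is $C_\varphi f=f\circ\varphi$, a bounded linear operator on $L^\infty(T)$. *)

(* Defs.v *)
From HB Require Import structures.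
From mathcomp Require Import all_boot all_order all_algebra.
From mathcomp Require Import all_classical all_reals all_analysis.
From mathcomp Require Import complex.

Set Implicit Arguments.
Unset Strict Implicit.
Unset Printing Implicit Defensive.

Import Order.TTheory GRing.Theory Num.Theory.
Import numFieldNormedType.Exports.

Local Open Scope classical_set_scope.
Local Open Scope ring_scope.
Local Open Scope complex_scope.

(* The root [o] is an explicit argument rather than part of the structure of
   [T]. *)
Definition locally_finite (R : realType) (T : metricType R) (o : T) : Prop :=
  forall M : R, 0 < M -> finite_set [set v : T | mdist o v < M].

Definition unbounded (R : realType) (T : metricType R) (o : T) : Prop :=
  forall M : R, 0 < M -> exists v : T, M <= mdist o v.

(* The modulus as a real number: the norm of [R[i]] in MathComp takes its values
   in [R[i]] itself, see [complex_normE]. *)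
Notation modulus := Normc.normc.

Section Linfty_def.
Context {R : realType} {T : Type}.
Implicit Types f g : T -> R[i]^o.

Lemma complex_normE (z : R[i]) : `|z| = (modulus z)%:C.
Proof. by []. Qed.

Definition bounded_pred : {pred T -> R[i]^o} :=
  fun f => `[< bounded_fun f >].

Lemma bounded_funE f :
  bounded_fun f <-> exists M : R, forall v, modulus (f v) <= M.
Proof.
split.
- move=> /pinfty_ex_gt0[M M0] fM; exists (complex.Re M) => v.
  have : (modulus (f v))%:C <= M := fM v I.
  by rewrite -{1}(@RRe_real _ M) ?gtr0_real// lecR.
- move=> [M fM]; exists M%:C; split; first by apply/complex_realP; exists M.
  move=> x Mx v _; apply: le_trans (ltW Mx).
  by change ((modulus (f v))%:C <= M%:C); rewrite lecR.
Qed.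

Lemma bounded_predP f :
  reflect (exists M : R, forall v, modulus (f v) <= M) (f \in bounded_pred).
Proof.
exact: (equivP (asboolP _) (bounded_funE f)).
Qed.

Lemma modulus_ge0 (z : R[i]) : 0 <= modulus z.
Proof. by rewrite -lecR; exact: (normr_ge0 z). Qed.

Lemma bounded_submod : submod_closed bounded_pred.
Proof.
split=> [|a f g].
  by apply/bounded_predP; exists 0 => v; rewrite Normc.normc0.
move=> /bounded_predP[M fM] /bounded_predP[N gN]; apply/bounded_predP.
exists (modulus a * M + N) => v.
apply: (le_trans (le_normcD _ _)); apply: lerD => //.
by rewrite Normc.normcM ler_wpM2l// modulus_ge0.
Qed.

HB.instance Definition _ :=
  GRing.isSubmodClosed.Build R[i] (T -> R[i]^o) bounded_pred bounded_submod.

End Linfty_def.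

Record Linfty (R : realType) (T : Type) := MkLinfty {
  Linfty_fun :> T -> R[i]^o;
  Linfty_bounded : Linfty_fun \in @bounded_pred R T
}.

HB.instance Definition _ (R : realType) (T : Type) :=
  [isSub for @Linfty_fun R T].
HB.instance Definition _ (R : realType) (T : Type) :=
  [Choice of Linfty R T by <:].
HB.instance Definition _ (R : realType) (T : Type) :=
  [SubChoice_isSubLmodule of Linfty R T by <:].

(* [normedModType R[i]] requires an [R[i]]-valued norm, so the norm of [f] is
   the real number [sup_norm f] seen in [R[i]]. *)
Section Linfty_norm.
Context {R : realType} {T : Type}.
Implicit Types f g : Linfty R T.

Definition sup_norm (f : T -> R[i]) : R := sup [set modulus (f v) | v in setT].

Lemma sup_norm_ub f v : modulus (f v) <= sup_norm f.
Proof.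
apply: ub_le_sup; last by exists v.
have /bounded_predP[M fM] := Linfty_bounded f.
by exists M => x [w _ <-]; exact: fM.
Qed.

Lemma sup_norm_le f (M : R) :
  0 <= M -> (forall v, modulus (f v) <= M) -> sup_norm f <= M.
Proof.
move=> M0 fM; have [[v _]|T0] := pselect (exists v : T, True).
  by apply: sup_le_ub => [|_ [w _ <-]//]; exists (modulus (f v)); exists v.
rewrite /sup_norm (_ : [set _ | _ in _] = set0) ?sup0//.
by rewrite -subset0 => x [w _ _]; apply: T0; exists w.
Qed.

Lemma sup_norm_ge0 f : 0 <= sup_norm f.
Proof.
have [[v _]|T0] := pselect (exists v : T, True).
  exact: le_trans (modulus_ge0 _) (sup_norm_ub f v).
rewrite /sup_norm (_ : [set _ | _ in _] = set0) ?sup0//.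
by rewrite -subset0 => x [w _ _]; apply: T0; exists w.
Qed.

Let norm f : R[i] := (sup_norm f)%:C.

Let normD f g : norm (f + g) <= norm f + norm g.
Proof.
rewrite /norm -rmorphD lecR; apply: sup_norm_le => [|v].
  by rewrite addr_ge0// sup_norm_ge0.
by apply: le_trans (le_normcD _ _) _; rewrite lerD// sup_norm_ub.
Qed.

Let normZ (a : R[i]) f : norm (a *: f) = `|a| * norm f.
Proof.
rewrite complex_normE /norm -rmorphM; congr (_%:C); apply/le_anti/andP; split.
  apply: sup_norm_le => [|v]; first by rewrite mulr_ge0 ?modulus_ge0 ?sup_norm_ge0.
  by rewrite Normc.normcM ler_wpM2l ?modulus_ge0 ?sup_norm_ub.
have [->|a0] := eqVneq a 0; first by rewrite Normc.normc0 mul0r sup_norm_ge0.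
have a_gt0 : 0 < modulus a by rewrite -ltcR -complex_normE normr_gt0.
rewrite -ler_pdivlMl//; apply: sup_norm_le => [|v].
  by rewrite mulr_ge0 ?invr_ge0 ?modulus_ge0 ?sup_norm_ge0.
by rewrite ler_pdivlMl// -Normc.normcM (sup_norm_ub (a *: f)).
Qed.

Let norm0_eq0 f : norm f = 0 -> f = 0.
Proof.
move=> /complexI f0; apply: val_inj; apply/funext => v.
apply: Normc.eq0_normc; apply/le_anti.
by rewrite modulus_ge0 andbT -f0 sup_norm_ub.
Qed.

HB.instance Definition _ :=
  Lmodule_isNormed.Build R[i] (Linfty R T) normD normZ norm0_eq0.

Lemma Linfty_normE f : `|f| = (sup_norm f)%:C.
Proof. by []. Qed.

End Linfty_norm.

Section composition.
Context {R : realType} {T : Type}.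
Implicit Types (phi : T -> T) (f : Linfty R T).

Lemma comp_bounded phi f : (f \o phi : T -> R[i]^o) \in bounded_pred.
Proof.
have /bounded_predP[M fM] := Linfty_bounded f.
by apply/bounded_predP; exists M => v; exact: fM.
Qed.

Definition comp_op phi f : Linfty R T := MkLinfty (comp_bounded phi f).

Lemma comp_op_linear phi : linear (comp_op phi).
Proof. by move=> a f g; apply: val_inj. Qed.

HB.instance Definition _ phi :=
  GRing.isLinear.Build R[i] (Linfty R T) (Linfty R T) *:%R (comp_op phi)
    (comp_op_linear phi).

Lemma comp_op_bounded phi f : `|comp_op phi f| <= `|f|.
Proof.
rewrite lecR; apply: sup_norm_le => [|v]; first exact: sup_norm_ge0.
exact: (sup_norm_ub f (phi v)).
Qed.

Lemma comp_op_continuous phi : continuous (comp_op phi).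
Proof.
apply/bounded_linear_continuous/bounded_funP => r; exists r => f.
exact/le_trans/comp_op_bounded.
Qed.

End composition.

Arguments comp_op R {T} phi f.

(* The norms being real elements of [R[i]], the supremum is taken over their
   real parts; it is an extended real, equal to [+oo] if [A] is unbounded. *)
Definition op_norm (R : realType) (V W : normedModType R[i])
    (A : {linear V -> W}) : \bar R :=
  ereal_sup [set (complex.Re `|A f|)%:E | f in [set f : V | `|f| <= 1]].

(* Main.v *)
Require Import Defs.
From mathcomp Require Import all_boot all_order all_algebra.
From mathcomp Require Import all_classical all_reals all_analysis.
From mathcomp Require Import complex.

Import Order.TTheory GRing.Theory Num.Theory.
Import numFieldNormedType.Exports.

Local Open Scope ring_scope.

(** The upper bound is the triangle inequality, since composition operators
    are contractions.  For the lower bound, pick [v] with [phi v <> psi v];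
    the function equal to [1] at [phi v] and to [-1] everywhere else lies in
    the unit ball, and [C_phi - C_psi] maps it to a function whose value at
    [v] is [1 - (-1) = 2]; thus the norm is attained. *)

Section separation.
Context {R : realType} {T : Type}.

Definition sign_at (p : T) : T -> R[i]^o :=
  fun v => if pselect (v = p) then 1 else - 1.

Lemma modulus_sign_at (p v : T) : modulus (sign_at p v) = 1.
Proof.
rewrite /sign_at; case: pselect => ?; first exact: Normc.normc1.
exact: etrans (normcN _) (Normc.normc1 _).
Qed.

Lemma sign_at_bounded (p : T) : sign_at p \in bounded_pred.
Proof. by apply/bounded_predP; exists 1 => v; rewrite modulus_sign_at. Qed.

Lemma sign_at_separates (p q : T) : p <> q -> sign_at p p - sign_at p q = 2.
Proof.
move=> pq; rewrite /sign_at; case: pselect => // ? /=.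
by case: pselect => [/esym//|? /=]; rewrite opprK.
Qed.

End separation.

Lemma comp_op_sub_le (R : realType) (T : Type) (phi psi : T -> T)
    (f : Linfty R T) :
  `|f| <= 1 -> complex.Re `|comp_op R phi f - comp_op R psi f| <= 2.
Proof.
move=> f1; have : `|comp_op R phi f - comp_op R psi f| <= 1 + 1.
  apply: le_trans (ler_normB _ _) _.
  by apply: lerD; apply: le_trans f1; exact: comp_op_bounded.
by rewrite lecE => /andP[].
Qed.

Theorem theorem3p2 (R : realType) (T : metricType R) (o : T)
    (T_unbounded : unbounded o) (T_locally_finite : locally_finite o)
    (phi psi : T -> T) (phi_neq_psi : phi <> psi) :
  op_norm (comp_op R phi \- comp_op R psi) = 2%:E.
Proof.
have [v phi_psi_v] : exists v, phi v <> psi v.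
  by apply/existsNP => phi_psi; apply: phi_neq_psi; exact/funext.
apply/le_anti/andP; split.
  by apply: ge_ereal_sup => _ [f f1 <-]; rewrite lee_fin comp_op_sub_le.
pose f : Linfty R T := MkLinfty (@sign_at_bounded R T (phi v)).
have f1 : `|f| <= 1.
  rewrite Linfty_normE lecR; apply: sup_norm_le => // w.
  by rewrite modulus_sign_at.
apply: le_trans (ereal_sup_ubound _); last by exists f.
rewrite lee_fin.
apply: le_trans (sup_norm_ub (comp_op R phi f - comp_op R psi f) v).
suff -> : (comp_op R phi f - comp_op R psi f) v = (2 : R)%:C%C.
  by rewrite -lecR -complex_normE rmorph_nat normr_nat.
by rewrite rmorph_nat; exact: sign_at_separates.
Qed.
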